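(* Let $n\ge 2$ be even, let $s\ge 1$, $k\ge 1$, and let $f\in\mathbb{R}[T]$ be $f(T)=\sum_{i=0}^{s}A_{2i+1}T^{2i+1}$ with $A_{2i+1}<0$ for $i=0,\dots,s$. Let $R(x_{n+1})=\sum_{l=1}^{k}d_{2l}\,x_{n+1}^{2l}$ with $d_{2l}>0$ for $l=1,\dots,k$, and let $\lambda<0$. Let $a_1,a_2\in\mathbb{R}$ and, for $j=2,\dots,n/2$, let $a_{2j-1},a_{2j}\in\mathbb{R}[x_1,\dots,x_{2j-2}]$. Define $H=(H_1,\dots,H_n):\mathbb{R}^n\to\mathbb{R}^n$ by, for $j=1,\dots,n/2$, $$H_{2j-1}=a_{2j}\,f(a_{2j-1}x_{2j-1}+a_{2j}x_{2j}),\qquad H_{2j}=-a_{2j-1}\,f(a_{2j-1}x_{2j-1}+a_{2j}x_{2j}).$$ Then, writing $x=(x_1,\dots,x_n)$, the vector field $F:\mathbb{R}^{n+1}\to\mathbb{R}^{n+1}$, $$F(x_1,\dots,x_{n+1})=(-x_2,x_1,-x_4,x_3,\dots,-x_n,x_{n-1},-x_{n+1}R(x_{n+1}))+R(x_{n+1})\,(\lambda x+H(x),0),$$ is an almost Hurwitz vector field.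
   Context: A $C^1$ vector field $F:\mathbb{R}^m\to\mathbb{R}^m$ is called Hurwitz if for every $x\in\mathbb{R}^m$ all eigenvalues of the Jacobian matrix $JF(x)$ have negative real part. It is called almost Hurwitz if this condition on the eigenvalues of $JF(x)$ holds for all $x$ outside a set of Lebesgue measure zero in $\mathbb{R}^m$. In the definition of $H$, the coefficients $a_{2j-1},a_{2j}$ are evaluated at $(x_1,\dots,x_{2j-2})$ (constants when $j=1$). *)

(* Defs.v *)
From HB Require Import structures.
From mathcomp Require Import all_boot all_order all_algebra.
From mathcomp Require Import all_classical all_reals all_analysis.
From mathcomp Require Import complex.
(* Not imported: its notations clash with those of MathComp-Analysis. *)
From mathcomp Require mpoly.

Set Implicit Arguments.
Unset Strict Implicit.
Unset Printing Implicit Defensive.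

Import Order.TTheory GRing.Theory Num.Theory.
Import numFieldNormedType.Exports.

Local Open Scope classical_set_scope.
Local Open Scope ring_scope.

(* The library has no Lebesgue measure on R^m.  The one-dimensional
   construction is followed here: the outer measure is the infimum of the total
   volume over countable covers by boxes, and a set has Lebesgue measure zero
   exactly when its outer measure is zero. *)

Definition box (R : realType) (m : nat) (a b : 'rV[R]_m) : set 'rV[R]_m :=
  [set x | forall i, a 0 i <= x 0 i <= b 0 i].

Definition box_volume (R : realType) (m : nat) (a b : 'rV[R]_m) : R :=
  \prod_(i < m) (b 0 i - a 0 i).

(* The condition [a k <= b k] keeps [box_volume] from being negative. *)
Definition box_cover (R : realType) (m : nat) (N : set 'rV[R]_m)
    (a b : nat -> 'rV[R]_m) : Prop :=
  (forall k i, a k 0 i <= b k 0 i) /\ N `<=` \bigcup_k box (a k) (b k).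

Definition lebesgue_outer (R : realType) (m : nat) (N : set 'rV[R]_m) : \bar R :=
  ereal_inf [set v | exists a b : nat -> 'rV[R]_m, box_cover N a b /\
    v = (\sum_(0 <= k <oo) (box_volume (a k) (b k))%:E)%E].

Definition lebesgue_null (R : realType) (m : nat) (N : set 'rV[R]_m) : Prop :=
  lebesgue_outer N = 0%E.

Definition C1_field (R : realType) (m : nat) (F : 'rV[R]_m -> 'rV[R]_m) : Prop :=
  (forall x, differentiable F x) /\
  continuous (jacobian F : 'rV[R]_m -> 'M[R]_m).

(* Row-vector convention: [jacobian F x] acts by [v |-> v *m jacobian F x], so
   it is the transpose of the usual matrix of partial derivatives; [eigenvalue]
   also refers to row vectors. *)
Definition hurwitz_at (R : realType) (m : nat) (F : 'rV[R]_m -> 'rV[R]_m)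
    (x : 'rV[R]_m) : Prop :=
  forall z : R[i], eigenvalue (map_mx (real_complex R) (jacobian F x)) z ->
    complex.Re z < 0.

Definition almost_hurwitz (R : realType) (m : nat)
    (F : 'rV[R]_m -> 'rV[R]_m) : Prop :=
  C1_field F /\
  exists2 N : set 'rV[R]_m, lebesgue_null N & forall x, ~ N x -> hurwitz_at F x.

(* The even dimension is n = p.*2.  Coordinates are numbered from 0, so the pair
   (x_{2j-1}, x_{2j}) with 1 <= j <= n/2 has positions (2j, 2j+1) for j : 'I_p. *)

Lemma fst_pos_subproof (p : nat) (j : 'I_p) : (j.*2 < p.*2)%N.
Proof. by rewrite ltn_double. Qed.

Lemma snd_pos_subproof (p : nat) (j : 'I_p) : (j.*2.+1 < p.*2)%N.
Proof. by rewrite ltn_Sdouble. Qed.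

Lemma pair_of_subproof (p : nat) (i : 'I_p.*2) : (i./2 < p)%N.
Proof. by rewrite ltn_half_double. Qed.

Definition fst_pos (p : nat) (j : 'I_p) : 'I_p.*2 := Ordinal (fst_pos_subproof j).
Definition snd_pos (p : nat) (j : 'I_p) : 'I_p.*2 := Ordinal (snd_pos_subproof j).
Definition pair_of (p : nat) (i : 'I_p.*2) : 'I_p := Ordinal (pair_of_subproof i).

Definition quarter_turn (R : realType) (p : nat) (x : 'rV[R]_p.*2) : 'rV[R]_p.*2 :=
  \row_i (if odd i then x 0 (fst_pos (pair_of i))
          else - x 0 (snd_pos (pair_of i))).

(* [c] is a polynomial in the variables preceding the j-th pair. *)
Definition coef_at (R : realType) (p : nat) (j : 'I_p) (c : mpoly.mpoly j.*2 R)
    (x : 'rV[R]_p.*2) : R :=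
  mpoly.meval (fun i => x 0 (widen_ord (ltnW (fst_pos_subproof j)) i)) c.

(* [a j] and [b j] are the coefficients written a_{2j-1} and a_{2j} when pairs
   are numbered from 1. *)
Definition H_field (R : realType) (p : nat) (f : {poly R})
    (a b : forall j : 'I_p, mpoly.mpoly j.*2 R) (x : 'rV[R]_p.*2) :
    'rV[R]_p.*2 :=
  \row_i (let j := pair_of i in
          let aj := coef_at (a j) x in
          let bj := coef_at (b j) x in
          let fj := f.[aj * x 0 (fst_pos j) + bj * x 0 (snd_pos j)] in
          if odd i then - aj * fj else bj * fj).

Definition F_field (R : realType) (p : nat) (f r : {poly R}) (lambda : R)
    (a b : forall j : 'I_p, mpoly.mpoly j.*2 R) (y : 'rV[R]_(p.*2 + 1)) :
    'rV[R]_(p.*2 + 1) :=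
  let x := lsubmx y in
  let t := rsubmx y 0 0 in
  row_mx (quarter_turn x) (- t * r.[t])%:M
    + r.[t] *: row_mx (lambda *: x + H_field f a b x) 0.

(* Main.v *)
Require Import Defs.
From HB Require Import structures.
From mathcomp Require Import all_boot all_order all_algebra.
From mathcomp Require Import all_classical all_reals all_analysis.
From mathcomp Require Import complex.
From mathcomp Require mpoly.
From mathcomp Require Import ring.

(* The exceptional null set is the hyperplane t = 0, with t the last coordinate.
   The Jacobian is block triangular: the last coordinate contributes the
   eigenvalue -(R + t R')(t), and the j-th pair a 2x2 block with trace
   2 lambda R(t) and determinant lambda^2 R(t)^2 + 1 - R(t) (a^2 + b^2) f'(u),
   where u = a x + b y.  Off t = 0 we have R(t) > 0 and t R'(t) >= 0, while
   f' <= 0 everywhere, so each block has negative trace and positive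
   determinant.  No triangular determinant is computed: an eigenvector lives,
   at its last coordinate if that is nonzero and otherwise at its first nonzero
   pair, in a single diagonal block. *)

Set Implicit Arguments.
Unset Strict Implicit.
Unset Printing Implicit Defensive.

Import Order.TTheory GRing.Theory Num.Theory.
Import numFieldNormedType.Exports.
Local Open Scope ring_scope.

(** The matrix norm is a maximum over finitely many entries, so the entrywise neighbourhoods can be
    intersected. *)
Lemma continuous_mx (R : realType) (T : topologicalType) (m n : nat)
    (M : T -> 'M[R]_(m, n)) :
  (forall i j, continuous (fun x => M x i j)) -> continuous M.
Proof.
move=> Mc x; apply/cvgrPdist_le => /= e e0; near=> y.
rewrite [leLHS]/Num.Def.normr/= mx_normrE (bigmax_le _ (ltW e0))//= => i _.
rewrite !mxE/=; move: i; near: y; apply: filter_forall => /= i.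
exact: ((cvgrPdist_le _ _).1 (Mc i.1 i.2 x)).
Unshelve. all: by end_near. Qed.

(** * Real-valued functions of class C1 *)

Section C1.
Context {R : realType} {V : normedModType R}.
Implicit Types g h : V -> R.

(** Asking for continuity one direction at a time lets the sum and product rules apply as they
    stand; in [C1_field_coord] the basis directions yield the entries of the Jacobian. *)
Definition c1 g := (forall x, differentiable g x) /\
  forall v, continuous (fun x => 'D_v g x).

Lemma c1_continuous g : c1 g -> continuous g.
Proof. by move=> [dg _] x; exact: differentiable_continuous. Qed.

Lemma c1_cst (c : R) : c1 (fun=> c).
Proof.
split=> [x|v]; first exact: differentiable_cst.
under eq_fun do rewrite derive_cst; exact: cst_continuous.
Qed.

Lemma c1D g h : c1 g -> c1 h -> c1 (fun x => g x + h x).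
Proof.
move=> [dg cg] [dh ch]; split=> [x|v]; first exact: differentiableD.
have -> : (fun x => 'D_v (fun x => g x + h x) x) =
    (fun x => 'D_v g x + 'D_v h x).
  by apply/funext => x; rewrite -deriveD //; exact: diff_derivable.
by move=> x; apply: cvgD; [exact: cg|exact: ch].
Qed.

Lemma c1M g h : c1 g -> c1 h -> c1 (fun x => g x * h x).
Proof.
move=> /[dup] /c1_continuous cg [dg cdg] /[dup] /c1_continuous ch [dh cdh].
split=> [x|v]; first exact: differentiableM.
have -> : (fun x => 'D_v (fun x => g x * h x) x) =
    (fun x => g x * 'D_v h x + h x * 'D_v g x).
  by apply/funext => x; rewrite deriveM //; exact: diff_derivable.
by move=> x; apply: cvgD; apply: cvgM;
  [exact: cg|exact: cdh|exact: ch|exact: cdg].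
Qed.

Lemma c1N g : c1 g -> c1 (fun x => - g x).
Proof.
move=> cg; under eq_fun do rewrite -mulN1r.
by apply: c1M => //; exact: c1_cst.
Qed.

Lemma c1_sum (I : Type) (s : seq I) (G : I -> V -> R) :
  (forall i, c1 (G i)) -> c1 (fun x => \sum_(i <- s) G i x).
Proof.
move=> cG; elim: s => [|i s IHs].
  by under eq_fun do rewrite big_nil; exact: c1_cst.
by under eq_fun do rewrite big_cons; exact: c1D.
Qed.

Lemma c1_prod (I : Type) (s : seq I) (G : I -> V -> R) :
  (forall i, c1 (G i)) -> c1 (fun x => \prod_(i <- s) G i x).
Proof.
move=> cG; elim: s => [|i s IHs].
  by under eq_fun do rewrite big_nil; exact: c1_cst.
by under eq_fun do rewrite big_cons; exact: c1M.
Qed.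

Lemma c1X g k : c1 g -> c1 (fun x => g x ^+ k).
Proof.
move=> cg; elim: k => [|k IHk].
  by under eq_fun do rewrite expr0; exact: c1_cst.
by under eq_fun do rewrite exprS; exact: c1M.
Qed.

Lemma c1_horner (p : {poly R}) g : c1 g -> c1 (fun x => p.[g x]).
Proof.
move=> cg; under eq_fun do rewrite horner_coef.
by apply: c1_sum => i; apply: c1M; [exact: c1_cst|exact: c1X].
Qed.

Lemma c1_meval k (c : mpoly.mpoly k R) (G : 'I_k -> V -> R) :
  (forall i, c1 (G i)) -> c1 (fun x => mpoly.meval (G^~ x) c).
Proof.
move=> cG; under eq_fun do rewrite mpoly.mevalE.
apply: c1_sum => m; apply: c1M; first exact: c1_cst.
by apply: c1_prod => i; exact: c1X.
Qed.

(* A function which is polynomial along a line through [y] is differentiated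
   there with the formal derivative of that polynomial. *)
Lemma derive_line g (y w : V) (p : {poly R}) :
  (forall h : R, g (h *: w + y) = p.[h]) -> 'D_w g y = p^`().[0].
Proof.
move=> gp; rewrite derivE derive1E /derive; congr (lim (_ @ 0^')%classic).
apply/funext => h /=; rewrite gp [_%:A]mulr1 addr0.
by rewrite -(gp 0) scale0r add0r.
Qed.

End C1.

Lemma c1_coord (R : realType) m n (i : 'I_m) (j : 'I_n) :
  c1 (fun y : 'M[R]_(m, n) => y i j).
Proof.
split=> [x|v]; first exact: differentiable_coord.
have -> : (fun x => 'D_v (fun y : 'M[R]_(m, n) => y i j) x) = fun=> v i j.
  apply/funext => x; rewrite (@derive_line _ _ _ _ _ (v i j *: 'X + (x i j)%:P)).
    by rewrite !poly.derivE !hornerE.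
  by move=> h; rewrite !mxE !hornerE mulrC.
exact: cst_continuous.
Qed.

(** * Vector fields of class C1 and their Jacobians *)

Lemma derive_mxE (R : realType) (V : normedModType R) m n
    (F : V -> 'M[R]_(m, n)) x v i j :
  differentiable F x -> ('D_v F x) i j = 'D_v (fun y => F y i j) x.
Proof. by move=> dF; rewrite derive_mx ?mxE //; exact: diff_derivable. Qed.

Lemma C1_field_coord (R : realType) m (F : 'rV[R]_m -> 'rV[R]_m) :
  (forall j, c1 (fun y => F y 0 j)) -> C1_field F.
Proof.
move=> cF; have dF x : differentiable F x.
  have -> : F = \sum_(j < m) fun y => F y 0 j *: delta_mx 0 j.
    by apply/funext => y; rewrite fct_sumE -row_sum_delta.
  by apply: differentiable_sum => j; apply: differentiableZl; exact: (cF j).1.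
split=> //; apply: continuous_mx => i j.
have -> : (fun x => jacobian F x i j) =
    (fun x => 'D_(delta_mx 0 i) (fun y => F y 0 j) x).
  apply/funext => x.
  by rewrite -derive_mxE // deriveEjacobian // -rowE [RHS]mxE.
exact: (cF j).2.
Qed.

(** Turns an eigenvector equation into equations between directional derivatives, so that no entry
    of the Jacobian has to be computed. *)
Lemma mulmx_jacobian (R : realType) m (F : 'rV[R]_m -> 'rV[R]_m) x v j :
  C1_field F -> (v *m jacobian F x) 0 j = 'D_v (fun y => F y 0 j) x.
Proof. by move=> [dF _]; rewrite -deriveEjacobian // derive_mxE. Qed.

(** * Coordinate hyperplanes are null *)

Lemma hyperplane_null (R : realType) m (i0 : 'I_m) :
  lebesgue_null [set x : 'rV[R]_m | x 0 i0 = 0]%classic.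
Proof.
apply/eqP; rewrite eq_le; apply/andP; split.
  apply: ereal_inf_lbound.
  (* The cubes [-k, k]^m flattened to thickness zero in coordinate [i0]: each has volume zero, and
     together they exhaust the hyperplane. *)
  pose b (k : nat) : 'rV[R]_m := \row_i (if i == i0 then 0 else k%:R).
  exists (fun k => - b k), b; split; last first.
    rewrite eseries0 // => k _ _; rewrite /box_volume (bigD1 i0) //=.
    by rewrite !mxE eqxx oppr0 subrr mul0r.
  split=> [k i|x /= x0].
    by rewrite !mxE; case: eqP => _; rewrite ?oppr0 // ge0_cp // ler0n.
  (* The sum of the absolute values dominates every single coordinate. *)
  exists (Num.bound (\sum_i `|x 0 i|)) => // i; rewrite !mxE.
  case: eqP => [->|_]; first by rewrite x0 oppr0 lexx.
  rewrite -ler_norml (le_trans _ (ltW (archi_boundP _))) ?sumr_ge0 //.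
  by rewrite (bigD1 i) //= lerDl sumr_ge0.
apply/ereal_infP => _ [a [b [[ab _] ->]]].
apply: nneseries_ge0 => k _ _; rewrite lee_fin.
by apply: prodr_ge0 => i _; rewrite subr_ge0.
Qed.

(** * Complex eigenvalues of real matrices *)

Lemma eigenvalue_real_pair (R : realType) m (J : 'M[R]_m) (z : R[i]) :
  eigenvalue (map_mx (real_complex R) J) z ->
  exists vr vi : 'rV[R]_m, [/\ (vr != 0) || (vi != 0),
    vr *m J = complex.Re z *: vr - complex.Im z *: vi &
    vi *m J = complex.Im z *: vr + complex.Re z *: vi].
Proof.
move=> /eigenvalueP[v vJ v0].
have ReM (x : R[i]) (c : R) :
  complex.Re (x * real_complex R c) = complex.Re x * c.
  by case: x => xr xi /=; rewrite mulr0 subr0.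
have ImM (x : R[i]) (c : R) :
  complex.Im (x * real_complex R c) = complex.Im x * c.
  by case: x => xr xi /=; rewrite mulr0 add0r.
(* As [J] is real, the eigenvector equation splits into real and imaginary parts; both vectors are
   real directions along which a field can be differentiated. *)
exists (map_mx (@complex.Re R) v), (map_mx (@complex.Im R) v); split.
- apply: contraNT v0; rewrite negb_or !negbK => /andP[/eqP/rowP r0 /eqP/rowP i0].
  apply/eqP/rowP => j; move: (r0 j) (i0 j); rewrite !mxE.
  by case: (v 0 j) => /= ? ? -> ->.
- apply/rowP => j; move/rowP/(_ j)/(congr1 (@complex.Re R)) : vJ.
  rewrite !mxE (big_morph (@complex.Re R) (id1 := 0) (op1 := +%R)) //.
    under eq_bigr do rewrite mxE ReM.
    under [in X in _ -> X]eq_bigr do rewrite mxE.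
    by move=> ->; case: z (v 0 j) => ? ? [].
  by move=> [? ?] [].
- apply/rowP => j; move/rowP/(_ j)/(congr1 (@complex.Im R)) : vJ.
  rewrite !mxE (big_morph (@complex.Im R) (id1 := 0) (op1 := +%R)) //.
    under eq_bigr do rewrite mxE ImM.
    under [in X in _ -> X]eq_bigr do rewrite mxE.
    by move=> ->; case: z (v 0 j) => ? ? [? ?] /=; ring.
  by move=> [? ?] [].
Qed.

(* By Cayley-Hamilton, [X = Y = 0] where [X + i Y = z^2 - T z + D] for
   [z = u + i w], [T] the trace and [D] the determinant. *)
Lemma hurwitz2 (R : realDomainType) (m11 m12 m21 m22 u w p1 p2 q1 q2 : R) :
  m11 + m22 < 0 -> 0 < m11 * m22 - m12 * m21 ->
  p1 * m11 + p2 * m21 = u * p1 - w * q1 ->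
  p1 * m12 + p2 * m22 = u * p2 - w * q2 ->
  q1 * m11 + q2 * m21 = w * p1 + u * q1 ->
  q1 * m12 + q2 * m22 = w * p2 + u * q2 ->
  [|| p1 != 0, p2 != 0, q1 != 0 | q2 != 0] -> u < 0.
Proof.
move=> T0 D0 e1 e2 e3 e4 nz.
pose T := m11 + m22; pose D := m11 * m22 - m12 * m21.
pose X := u ^+ 2 - w ^+ 2 - T * u + D; pose Y := 2 * u * w - T * w.
(* One of four component equations. The others come from swapping the two coordinates, from
   exchanging real and imaginary parts with [w] negated, and from doing both. *)
have key v p1' p2' q1' q2' (a11 a12 a21 a22 : R) :
    p1' * a11 + p2' * a21 = u * p1' - v * q1' ->
    p1' * a12 + p2' * a22 = u * p2' - v * q2' ->
    q1' * a11 + q2' * a21 = v * p1' + u * q1' ->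
    (u ^+ 2 - v ^+ 2 - (a11 + a22) * u + (a11 * a22 - a12 * a21)) * p1'
      = (2 * u * v - (a11 + a22) * v) * q1'.
  move=> /eqP; rewrite -subr_eq0 => /eqP E1 /eqP.
  rewrite -subr_eq0 => /eqP E2 /eqP; rewrite -subr_eq0 => /eqP E3.
  apply/eqP; rewrite -subr_eq0; apply/eqP.
  (* The zeros stand for the three equations: the first two multipliers, from the adjugate of M - u,
     eliminate [p2'], and the third cancels the resulting [q2'] term. *)
  transitivity ((a22 - u) * 0 - a21 * 0 + v * 0); last by ring.
  by rewrite -{1}E1 -{1}E2 -{1}E3; ring.
have h1 : X * p1 = Y * q1 := key _ _ _ _ _ _ _ _ _ e1 e2 e3.
have h2 : X * p2 = Y * q2.
  have := key w p2 p1 q2 q1 m22 m21 m12 m11; rewrite /X /Y /T /D.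
  by rewrite (addrC m22) (mulrC m22) (mulrC m21); apply; rewrite addrC.
have h3 : X * q1 = - Y * p1.
  have := key (- w) q1 q2 p1 p2 m11 m12 m21 m22; rewrite /X /Y /T /D.
  by rewrite sqrrN !mulrN -opprD => ->; rewrite ?e1 ?e3 ?e4 //; ring.
have h4 : X * q2 = - Y * p2.
  have := key (- w) q2 q1 p2 p1 m22 m21 m12 m11; rewrite /X /Y /T /D.
  rewrite (addrC m22) (mulrC m22) (mulrC m21) sqrrN !mulrN -opprD => -> //.
  - by rewrite addrC e4; ring.
  - by rewrite addrC e3; ring.
  - by rewrite addrC e2; ring.
have XY : X ^+ 2 + Y ^+ 2 = 0.
  (* The two premises say (X + iY)(p + iq) = 0; multiplying by the conjugate X - iY shows that X^2 +
     Y^2 kills both p and q. *)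
  have hp (p q : R) : X * p = Y * q -> X * q = - Y * p ->
      (p != 0) || (q != 0) -> X ^+ 2 + Y ^+ 2 = 0.
    move=> f1 f2 /orP pq; apply/eqP.
    have /eqP : (X ^+ 2 + Y ^+ 2) * p = 0.
      transitivity (X * (X * p) + Y ^+ 2 * p); first by ring.
      by rewrite f1 mulrCA f2; ring.
    have /eqP : (X ^+ 2 + Y ^+ 2) * q = 0.
      transitivity (X * (X * q) + Y * (Y * q)); first by ring.
      by rewrite f2 -f1; ring.
    by rewrite !mulf_eq0; case: pq => /negPf->; rewrite !orbF.
  case/or4P: nz => nz; [apply: (hp _ _ h1 h3)|apply: (hp _ _ h2 h4)
                       |apply: (hp _ _ h1 h3)|apply: (hp _ _ h2 h4)];
    by rewrite nz ?orbT.
move/eqP: XY; rewrite paddr_eq0 ?sqr_ge0 // !sqrf_eq0 => /andP[/eqP X0 /eqP Y0].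
(* Either u = T / 2 < 0, or w = 0 and X = u^2 - T u + D, which would be positive if u >= 0. *)
have : w * (2 * u - T) = 0 by rewrite -Y0 /Y; ring.
move/eqP; rewrite mulf_eq0 subr_eq0 => /orP[/eqP w0|/eqP uT]; last first.
  by rewrite -(pmulr_rlt0 _ (ltr0Sn _ 1)) uT.
rewrite ltNge; apply/negP => u0.
have Tu : T * u <= 0 by rewrite nmulr_rle0.
have : 0 < X.
  rewrite /X w0 expr0n /= subr0 ltr_wpDl // subr_ge0 (le_trans Tu) //.
  exact: sqr_ge0.
by rewrite X0 ltxx.
Qed.

(** * Coordinates of the field and its smoothness *)

Lemma pair_of_fst p (j : 'I_p) : pair_of (fst_pos j) = j.
Proof. by apply: val_inj; rewrite /= doubleK. Qed.

Lemma pair_of_snd p (j : 'I_p) : pair_of (snd_pos j) = j.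
Proof. by apply: val_inj; rewrite /= uphalf_double. Qed.

Lemma fst_or_snd p (i : 'I_p.*2) :
  i = fst_pos (pair_of i) \/ i = snd_pos (pair_of i).
Proof.
have := odd_double_half i; case: (odd i) => /= ii; [right|left];
  by apply: val_inj; rewrite /= -{1}ii.
Qed.

Section Field.
Context {R : realType} {p : nat}.
Variables (f r : {poly R}) (lambda : R).
Variables a b : forall j : 'I_p, mpoly.mpoly j.*2 R.
Implicit Types (y w : 'rV[R]_(p.*2 + 1)) (j : 'I_p).

Local Notation F := (F_field f r lambda a b).
Local Notation last := (rshift p.*2 (0 : 'I_1)).
Local Notation t y := (y 0 last).
Local Notation fst_ y j := (y 0 (lshift 1 (fst_pos j))).
Local Notation snd_ y j := (y 0 (lshift 1 (snd_pos j))).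
Local Notation A y j := (coef_at (a j) (lsubmx y)).
Local Notation B y j := (coef_at (b j) (lsubmx y)).

Lemma F_field_last y : F y 0 last = - t y * r.[t y].
Proof.
by rewrite mxE row_mxEr [X in _ + X]mxE row_mxEr !mxE eqxx mulr1n mulr0 addr0.
Qed.

Lemma F_field_fst y j : F y 0 (lshift 1 (fst_pos j)) =
  - snd_ y j + r.[t y] * (lambda * fst_ y j
    + B y j * f.[A y j * fst_ y j + B y j * snd_ y j]).
Proof.
rewrite mxE row_mxEl [X in _ + X]mxE row_mxEl !mxE /= odd_double pair_of_fst.
by rewrite !mxE.
Qed.

Lemma F_field_snd y j : F y 0 (lshift 1 (snd_pos j)) =
  fst_ y j + r.[t y] * (lambda * snd_ y j
    - A y j * f.[A y j * fst_ y j + B y j * snd_ y j]).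
Proof.
rewrite mxE row_mxEl [X in _ + X]mxE row_mxEl !mxE /= odd_double /= pair_of_snd.
by rewrite !mxE mulNr.
Qed.

Lemma c1_coef_at j (c : mpoly.mpoly j.*2 R) :
  c1 (fun y : 'rV[R]_(p.*2 + 1) => coef_at c (lsubmx y)).
Proof.
apply: (@c1_meval _ _ _ c (fun i y => lsubmx y 0
  (widen_ord (ltnW (fst_pos_subproof j)) i))) => i.
by under eq_fun do rewrite mxE; exact: c1_coord.
Qed.

Lemma F_field_C1 : C1_field F.
Proof.
apply: C1_field_coord => i; have [{}i ->|{}i ->] := split_ordP i; last first.
  rewrite ord1; under eq_fun do rewrite F_field_last.
  by apply: c1M; [apply: c1N|apply: c1_horner]; exact: c1_coord.
have cf j : c1 (fun y => f.[A y j * fst_ y j + B y j * snd_ y j]).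
  by apply: c1_horner; apply: c1D; apply: c1M;
    do ?exact: c1_coef_at; exact: c1_coord.
have cr : c1 (fun y => r.[t y]) by apply: c1_horner; exact: c1_coord.
have [->|->] := fst_or_snd i; move: (pair_of i) => {i} j.
  under eq_fun do rewrite F_field_fst.
  apply: c1D; first by apply: c1N; exact: c1_coord.
  apply: c1M => //; apply: c1D; apply: c1M => //.
  - exact: c1_cst.
  - exact: c1_coord.
  - exact: c1_coef_at.
under eq_fun do rewrite F_field_snd.
apply: c1D; first exact: c1_coord.
apply: c1M => //; apply: c1D; first by apply: c1M; [exact: c1_cst|exact: c1_coord].
by apply: c1N; apply: c1M => //; exact: c1_coef_at.
Qed.

(** * Directional derivatives of the components *)

Lemma derive_F_last y w : 'D_w (fun y => F y 0 last) y =
  - (r.[t y] + t y * r^`().[t y]) * t w.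
Proof.
pose l := (t y)%:P + t w *: 'X.
rewrite (@derive_line _ _ _ _ _ (- (l * (r \Po l)))) => [|h]; last first.
  have lh : l.[h] = h * t w + t y by rewrite !hornerE; ring.
  by rewrite F_field_last !mxE hornerN hornerM horner_comp lh mulNr.
rewrite derivN derivM deriv_comp /l !poly.derivE !(hornerE, horner_comp) /=.
ring.
Qed.

Section DirectionFromPair.
Variables (y w : 'rV[R]_(p.*2 + 1)) (j : 'I_p).
Hypothesis w_before : forall i : 'I_p.*2, (i < j.*2)%N -> w 0 (lshift 1 i) = 0.
Hypothesis w_last : t w = 0.

(** The coefficients of pair [j] involve only earlier coordinates, which [w] leaves fixed. Entries
    of [w] after pair [j] are unrestricted, since that pair of components does not depend on
    them. *)
Lemma coef_at_line (c : mpoly.mpoly j.*2 R) (h : R) :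
  coef_at c (lsubmx (h *: w + y)) = coef_at c (lsubmx y).
Proof.
by apply: mpoly.meval_eq => i; rewrite !mxE w_before ?mulr0 ?add0r /=.
Qed.

Lemma affine_argument : exists2 u : {poly R},
  forall h, u.[h] = A y j * (h * fst_ w j + fst_ y j)
    + B y j * (h * snd_ w j + snd_ y j) &
  u^`() = (A y j * fst_ w j + B y j * snd_ w j)%:P.
Proof.
exists ((A y j * fst_ y j + B y j * snd_ y j)%:P
  + (A y j * fst_ w j + B y j * snd_ w j) *: 'X) => [h|].
  by rewrite !hornerE; ring.
by rewrite !poly.derivE add0r alg_polyC.
Qed.

Let phi := f^`().[A y j * fst_ y j + B y j * snd_ y j].

Lemma derive_F_fst : 'D_w (fun y => F y 0 (lshift 1 (fst_pos j))) y =
  fst_ w j * (r.[t y] * (lambda + A y j * B y j * phi))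
  + snd_ w j * (r.[t y] * B y j ^+ 2 * phi - 1).
Proof.
have [u u_line u'] := affine_argument.
(* The component restricted to the line, with [r], [A] and [B] frozen at [y]; only the pair itself
   and the argument of [f] vary with [h]. *)
pose q := - ((snd_ y j)%:P + snd_ w j *: 'X) + r.[t y] *:
  (lambda *: ((fst_ y j)%:P + fst_ w j *: 'X) + B y j *: (f \Po u)).
rewrite (@derive_line _ _ _ _ _ q) => [|h]; last first.
  rewrite F_field_fst !coef_at_line !mxE w_last mulr0 add0r.
  by rewrite !(hornerE, horner_comp) u_line /=; ring.
rewrite /q !(poly.derivE, deriv_comp) u' !(hornerE, horner_comp) u_line /=.
by rewrite !mul0r !add0r -/phi; ring.
Qed.

Lemma derive_F_snd : 'D_w (fun y => F y 0 (lshift 1 (snd_pos j))) y =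
  fst_ w j * (1 - r.[t y] * A y j ^+ 2 * phi)
  + snd_ w j * (r.[t y] * (lambda - A y j * B y j * phi)).
Proof.
have [u u_line u'] := affine_argument.
pose q := ((fst_ y j)%:P + fst_ w j *: 'X) + r.[t y] *:
  (lambda *: ((snd_ y j)%:P + snd_ w j *: 'X) - A y j *: (f \Po u)).
rewrite (@derive_line _ _ _ _ _ q) => [|h]; last first.
  rewrite F_field_snd !coef_at_line !mxE w_last mulr0 add0r.
  by rewrite !(hornerE, horner_comp) u_line /=; ring.
rewrite /q !(poly.derivE, deriv_comp) u' !(hornerE, horner_comp) u_line /=.
by rewrite !mul0r !add0r -/phi; ring.
Qed.

End DirectionFromPair.

(** * Sign of the real parts of the eigenvalues *)

Hypothesis lambda_lt0 : lambda < 0.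
Hypothesis f'_le0 : forall x, f^`().[x] <= 0.

Lemma F_field_hurwitz y :
  0 < r.[t y] -> 0 <= t y * r^`().[t y] -> hurwitz_at F y.
Proof.
move=> r0 r'0 z /eigenvalue_real_pair[vr [vi [v0 /rowP er /rowP ei]]].
have [l0|] := boolP ((t vr != 0) || (t vi != 0)).
  move: (er last) (ei last); rewrite !(mulmx_jacobian _ _ _ F_field_C1).
  rewrite !derive_F_last !mxE; set c := _ + _ => er' ei'.
  have c0 : 0 < c by rewrite ltr_wpDr.
  (* The 1x1 block -c is doubled to the diagonal block -c I, with second components 0, to fit the
     2x2 criterion. *)
  apply: (@hurwitz2 _ (- c) 0 0 (- c) _ (complex.Im z)
    (t vr) 0 (t vi) 0); rewrite ?(mulr0, mul0r, addr0, subr0) //.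
  - by rewrite -opprD oppr_lt0 addr_gt0.
  - by rewrite mulrNN mulr_gt0.
  - by rewrite mulrC.
  - by rewrite mulrC.
  - by rewrite eqxx orbF.
rewrite negb_or !negbK => /andP[/eqP lr /eqP li].
pose P (i : 'I_p.*2) :=
  (vr 0 (lshift 1 i) != 0) || (vi 0 (lshift 1 i) != 0).
have [i0 Pi0] : exists i, P i.
  apply/existsP; apply: contraTT v0 => /existsPn nP.
  rewrite negb_or !negbK; apply/andP; split; apply/eqP/rowP => i; rewrite mxE;
    have [{}i ->|{}i ->] := split_ordP i; rewrite ?ord1 //;
    by move: (nP i); rewrite negb_or !negbK => /andP[/eqP ? /eqP ?].
have [i Pi imin] := arg_minnP (fun i : 'I_p.*2 => i : nat) Pi0.
pose j := pair_of i.
(* [i] may be either position of its pair, but [j.*2 <= i] in both cases, so minimality clears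
   everything before the pair. *)
have before (i' : 'I_p.*2) : (i' < j.*2)%N -> ~~ P i'.
  move=> i'j; apply/negP => /imin; rewrite leqNgt.
  by rewrite (leq_trans i'j) // -[leqRHS]odd_double_half leq_addl.
have rb (k : 'I_p.*2) : (k < j.*2)%N -> vr 0 (lshift 1 k) = 0.
  by move=> /before; rewrite negb_or !negbK => /andP[/eqP].
have ib (k : 'I_p.*2) : (k < j.*2)%N -> vi 0 (lshift 1 k) = 0.
  by move=> /before; rewrite negb_or !negbK => /andP[_ /eqP].
(* Only the two components of pair [j] are read off; their real and imaginary parts are the four
   equations of [hurwitz2]. *)
have := er (lshift 1 (fst_pos j)); have := ei (lshift 1 (fst_pos j)).
have := er (lshift 1 (snd_pos j)); have := ei (lshift 1 (snd_pos j)).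
rewrite !(mulmx_jacobian _ _ _ F_field_C1).
rewrite !(derive_F_fst _ rb lr) !(derive_F_fst _ ib li).
rewrite !(derive_F_snd _ rb lr) !(derive_F_snd _ ib li) !mxE.
set phi := f^`().[_]; have phi0 : phi <= 0 by exact: f'_le0.
set rt := r.[_] in r0 *; move=> e4 e2 e3 e1.
apply: (hurwitz2 _ _ e1 e2 e3 e4).
- rewrite -mulrDr addrACA subrr addr0 pmulr_rlt0 //.
  by rewrite -mulr2n pmulrn_llt0.
- set c := _ - _.
  (* The terms quadratic in [phi] cancel in the determinant. *)
  have -> : c = (rt * lambda) ^+ 2 + 1
      + rt * (A y j ^+ 2 + B y j ^+ 2) * (- phi) by rewrite /c; ring.
  rewrite ltr_wpDr ?ltr_wpDl ?sqr_ge0 // mulr_ge0 ?oppr_ge0 //.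
  by rewrite mulr_ge0 ?(ltW r0) // addr_ge0 ?sqr_ge0.
- move: Pi; rewrite /P; have [->|->] := fst_or_snd i;
    by case/orP => ->; rewrite ?orbT.
Qed.

End Field.

Theorem theorem1 (R : realType) (p s k : nat)
  (hp : (1 <= p)%N) (hs : (1 <= s)%N) (hk : (1 <= k)%N)
  (A : nat -> R) (hA : forall i : nat, (i <= s)%N -> A (2 * i + 1)%N < 0)
  (f : {poly R})
  (hf : f = \sum_(0 <= i < s.+1) A (2 * i + 1)%N *: 'X^(2 * i + 1))
  (d : nat -> R) (hd : forall l : nat, (1 <= l <= k)%N -> 0 < d (2 * l)%N)
  (r : {poly R})
  (hr : r = \sum_(1 <= l < k.+1) d (2 * l)%N *: 'X^(2 * l))
  (lambda : R) (hlambda : lambda < 0)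
  (a b : forall j : 'I_p, mpoly.mpoly j.*2 R) :
  almost_hurwitz (F_field f r lambda a b).
Proof.
split; first exact: F_field_C1.
exists [set y | y 0 (rshift p.*2 0) = 0]%classic; first exact: hyperplane_null.
move=> y /= /eqP t0; have even_ge0 (x : R) l : 0 <= x ^+ (2 * l).
  by rewrite exprM exprn_ge0 ?sqr_ge0.
apply: F_field_hurwitz => // [x||].
- rewrite hf raddf_sum horner_sum big_nat; apply: sumr_le0 => i /= ilts.
  rewrite derivZ derivXn hornerZ hornerMn hornerXn addn1 /=.
  by rewrite nmulr_rle0 ?mulrn_wge0 // -addn1 hA.
- have dl l : (1 <= l < k.+1)%N ->
      0 < (d (2 * l)%N *: 'X^(2 * l)).[y 0 (rshift p.*2 0)].
    move=> lk; rewrite hornerZ hornerXn pmulr_rgt0 ?hd //.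
    by rewrite exprM exprn_gt0 // exprn_even_gt0 ?t0.
  (* The term l = 1, present because [1 <= k], makes the sum strictly positive. *)
  rewrite hr horner_sum big_ltn // ltr_wpDr ?dl //.
  by rewrite big_nat sumr_ge0 // => l /andP[l1 lk]; rewrite ltW ?dl ?(ltnW l1).
- rewrite hr raddf_sum horner_sum big_nat mulr_sumr; apply: sumr_ge0 => l lk.
  (* The factor t restores the exponent lowered by differentiation: t (t^(2l))' = 2l t^(2l), an even
     power. *)
  rewrite /= derivZ derivXn hornerZ hornerMn hornerXn mulrCA mulrnAr -exprS.
  rewrite prednK ?muln_gt0 ?(andP lk).1 //.
  by rewrite pmulr_rge0 ?mulrn_wge0 // hd.
Qed.
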